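(* Let $t$ be a positive integer and $r$ an integer. There are infinitely many nonnegative integers $N\equiv r \pmod{t}$ for which $\overline{\mathcal{EO}}(2N)$ is even. Also, there are infinitely many nonnegative integers $M\equiv r \pmod{t}$ for which $\overline{\mathcal{EO}}(2M)$ is odd, provided there is at least one such $M$. Furthermore, if there does exist a nonnegative integer $M\equiv r \pmod{t}$ for which $\overline{\mathcal{EO}}(2M)$ is odd, then the smallest such $M$ is less than $$\frac{2^{9+j}3^7t^6}{d^2}\prod_{p\mid 6t}\left(1-\frac{1}{p^2}\right) - 2^j,$$ where $d = \gcd(12r-1,t)$, the product runs over the primes $p$ dividing $6t$, and $j$ is any integer with $2^j>\frac{t}{12}$.
   Context: For a nonnegative integer $n$, $\mathcal{EO}(n)$ is the number of partitions of $n$ in which every even part is less than each odd part. $\overline{\mathcal{EO}}(n)$ is the number of partitions counted by $\mathcal{EO}(n)$ in which only the largest even part appears an odd number of times (that is, if the partition has an even part, then the largest even part appears an odd number of times and every other part size that occurs appears an even number of times; if there are no even parts, every part size that occurs appears an even number of times). For example $\overline{\mathcal{EO}}(8)=5$, the relevant partitions being $8$, $4+2+2$, $3+3+2$, $3+3+1+1$, $1+1+1+1+1+1+1+1$. Equivalently (Andrews), $\overline{\mathcal{EO}}(n)$ is given by the generating function $$\sum_{n=0}^{\infty}\overline{\mathcal{EO}}(n)q^n=\frac{(q^4; q^4)_{\infty}^3}{(q^2; q^2)_{\infty}^2},\qquad (a; q)_{\infty}:=\prod_{m\geq 0}(1-aq^m).$$ *)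

(* Defs.v *)
From mathcomp Require Import all_boot.

Set Implicit Arguments.
Unset Strict Implicit.
Unset Printing Implicit Defensive.

(* A partition is the weakly decreasing list of its (positive) parts. *)
Definition is_partn (n : nat) (p : seq nat) : bool :=
  [&& sorted geq p, all (ltn 0) p & sumn p == n].

Definition evens_below_odds (p : seq nat) : bool :=
  allrel ltn [seq a <- p | ~~ odd a] [seq b <- p | odd b].

(* This is 0, hence not a part, when there are no even parts. *)
Definition largest_even (p : seq nat) : nat := \max_(a <- p | ~~ odd a) a.

Definition only_largest_even_odd_times (p : seq nat) : bool :=
  all (fun a => odd (count_mem a p) == (a == largest_even p)) p.

(* A partition of n has at most n parts, each at most n, so bounded sequences *)
(* over 'I_n.+1 represent each partition of n exactly once.                   *)
Definition EObar (n : nat) : nat :=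
  #|[pred s : n.-bseq 'I_n.+1 |
      let p := [seq val i | i <- s] in
      [&& is_partn n p, evens_below_odds p & only_largest_even_odd_times p]]|.

(* Main.v *)
Require Import Defs.
From mathcomp Require Import all_boot all_order all_algebra.
From mathcomp Require Import classical_sets cardinality.
From mathcomp Require Import zify ring lra.
From mathcomp Require Import qpoly.

(** The parity of EObar (2 * N) has a closed form: EObar (2 * N) is odd exactly
    when N = 2 k (3 k - 1) for some integer k, that is, when N is four times a
    generalized pentagonal number ([odd_EObarP]). Everything else is elementary
    arithmetic on this quadratic polynomial.

    To find the parity, let 2 m be the largest even part of a partition counted
    by EObar (2 * N), with m = 0 if there is none. Removing one copy of it
    and halving all multiplicities leaves a partition of N - m whose even parts
    are at most 2 m and whose odd parts exceed 2 m ([card_EOcodes]). Hence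
<<
      sum_N EObar(2N) q^N = sum_m q^m / ((q^2;q^2)_m (q^(2m+1);q^2)_oo)
                          = sum_(m,k) q^(m+k+2mk) / ((q^2;q^2)_m (q^2;q^2)_k),
>>
    where the second line is Euler's expansion of 1 / (z;q^2)_oo
    ([prod_geom_odd]). The double sum is symmetric in m and k, so modulo 2 only
    the diagonal survives; it is the square of
<<
      sum_m q^(m^2+m) / (q^2;q^2)_m = (-q^2;q^2)_oo
>>
    ([prod_distinct_even]), which is congruent to (q^4;q^4)_oo modulo 2
    ([EO_series_char2]). Euler's pentagonal number theorem, derived here from a
    finite identity of Shanks ([shanks]), finishes the computation. Power series
    are replaced throughout by elements of a commutative ring in which
    q^L = 0; the coefficients below L are recovered from polynomials modulo X^L.

    For the theorem itself: if N = 2 k (3 k - 1), then 6 N + 1 is the square of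
    6 k - 1, and two large numbers at distance 6 t cannot both be squares, so
    even values occur arbitrarily far in every progression. The residue of
    2 k (3 k - 1) modulo t depends only on k modulo t, so one odd value yields
    infinitely many, and choosing k with 2 |k| <= t yields one below 3 t^2.
    This is far below the stated bound: the product over primes is at
    least 1/2 ([prod_primes_ge_half]), d <= t and 2^j > t/12, so the bound
    exceeds 36 t 2^j >= 3 t^2. *)

Import Order.TTheory GRing.Theory Num.Theory.

Set Implicit Arguments.
Unset Strict Implicit.
Unset Printing Implicit Defensive.

(** * Euler's q-series identities with q nilpotent *)

Section Truncated.

Local Open Scope ring_scope.

Variables (R : comNzRingType) (q : R) (L : nat).
Hypothesis qL0 : q ^+ L = 0.

(** The series 1 / (1 - q^i), for i > 0. *)
Definition geom (i : nat) : R := \sum_(k < L) q ^+ (i * k).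

(** The series 1 / (q^2;q^2)_k. *)
Definition geomprod (k : nat) : R := \prod_(0 <= i < k) geom (2 * i.+1).

Lemma expr_nilp n : (L <= n)%N -> q ^+ n = 0.
Proof. by move=> /subnK <-; rewrite exprD qL0 mulr0. Qed.

Lemma geomK i : (0 < i)%N -> (1 - q ^+ i) * geom i = 1.
Proof.
move=> i_gt0.
have -> : geom i = \sum_(k < L) (q ^+ i) ^+ k.
  by apply: eq_bigr => k _; rewrite exprM.
apply: oppr_inj; rewrite -mulNr opprB -subrX1 -exprM expr_nilp ?sub0r //.
exact: leq_pmull.
Qed.

Lemma geomprodS k : (1 - q ^+ (2 * k.+1)) * geomprod k.+1 = geomprod k.
Proof. by rewrite /geomprod big_nat_recr //= mulrCA geomK ?mulr1. Qed.

(** Euler's expansion of 1 / (z;q^2)_oo at z = q^(2m+1). Write H for the right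
    hand side and H1 for the same sum at m + 1; both identities H - H1 = z H
    and (1 - z) H = H1 come from comparing terms with [geomprodS], and they
    produce the factors of the product one by one, starting from m = L, where
    both sides are 1. *)
Lemma prod_geom_odd m : (m <= L)%N ->
  \prod_(m <= i < L) geom (2 * i + 1)
  = \sum_(0 <= k < L) q ^+ ((2 * m + 1) * k) * geomprod k.
Proof.
move=> le_mL; rewrite -(subKn le_mL); elim: (L - m)%N (leq_subr m L) => [_|j IH].
  rewrite subn0 big_geq //; case: L qL0 => [|L' q0].
    by rewrite expr0 => /eqP; rewrite oner_eq0.
  rewrite big_nat_recl //= muln0 expr0 mul1r /geomprod big_geq // big1 ?addr0 //.
  move=> k _; rewrite -[X in q ^+ X](@subnK L'.+1); last by nia.
  by rewrite exprD q0 mulr0 mul0r.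
move=> lt_jL; have L_gt0 := leq_ltn_trans (leq0n j) lt_jL; set m' := (L - j.+1)%N.
have Em : (L - j = m'.+1)%N by rewrite /m'; lia.
rewrite big_ltn ?ltn_subrL // -/m' -Em IH ?(ltnW lt_jL) // Em.
set H1 := \sum_(0 <= k < L) _; set H := \sum_(0 <= k < L) _.
suff E1 : (1 - q ^+ (2 * m' + 1)) * H = H1.
  by rewrite -E1 mulrCA mulrA geomK ?mul1r // addn1.
have E2 : H - H1 = \sum_(1 <= k < L) q ^+ ((2 * m' + 1) * k) * geomprod k.-1.
  rewrite /H /H1 -sumrB big_ltn //.
  rewrite !muln0 subrr add0r big_add1 [RHS]big_add1; apply: eq_big_nat => k _ /=.
  rewrite -(geomprodS k); move: (geomprod _) => g.
  have -> : ((2 * m'.+1 + 1) * k.+1 = (2 * m' + 1) * k.+1 + 2 * k.+1)%N by lia.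
  by rewrite exprD; ring.
have E3 : H - H1 = q ^+ (2 * m' + 1) * H.
  rewrite E2 big_add1 /H -[in RHS](prednK L_gt0).
  rewrite big_nat_recr //= mulrDr mulrA -exprD.
  rewrite [X in _ + X * _]expr_nilp ?mul0r ?addr0; last first.
    by rewrite -mulnS (prednK L_gt0) leq_pmull // addn1.
  rewrite big_distrr /=; apply: eq_bigr => k _.
  by rewrite mulrA -exprD mulnS.
by rewrite mulrBl mul1r -E3 subKr.
Qed.

(** Euler's expansion of (-z;q^2)_oo at z = q^(2m+2), by the same descent on m:
    here H - H1 = q^(2m+2) H1. *)
Lemma prod_distinct_even m : (m <= L)%N ->
  \prod_(m <= i < L) (1 + q ^+ (2 * i.+1))
  = \sum_(0 <= k < L) q ^+ (k * k.+1 + 2 * m * k) * geomprod k.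
Proof.
move=> le_mL; rewrite -(subKn le_mL); elim: (L - m)%N (leq_subr m L) => [_|j IH].
  rewrite subn0 big_geq //; case: L qL0 => [|L' q0].
    by rewrite expr0 => /eqP; rewrite oner_eq0.
  rewrite big_nat_recl //= muln0 expr0 mul1r /geomprod big_geq // big1 ?addr0 //.
  move=> k _; rewrite -[X in q ^+ X](@subnK L'.+1); last by nia.
  by rewrite exprD q0 mulr0 mul0r.
move=> lt_jL; have L_gt0 := leq_ltn_trans (leq0n j) lt_jL; set m' := (L - j.+1)%N.
have Em : (L - j = m'.+1)%N by rewrite /m'; lia.
rewrite big_ltn ?ltn_subrL // -/m' -Em IH ?(ltnW lt_jL) // Em.
set H1 := \sum_(0 <= k < L) _; set H := \sum_(0 <= k < L) _.
suff E1 : H - H1 = q ^+ (2 * m'.+1) * H1 by rewrite mulrDl mul1r -E1 addrC subrK.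
have E2 : H - H1 = \sum_(1 <= k < L) q ^+ (k * k.+1 + 2 * m' * k) * geomprod k.-1.
  rewrite /H /H1 -sumrB big_ltn //.
  rewrite !muln0 subrr add0r big_add1 [RHS]big_add1; apply: eq_big_nat => k _ /=.
  rewrite -(geomprodS k); move: (geomprod _) => g.
  have -> : (k.+1 * k.+2 + 2 * m'.+1 * k.+1
             = k.+1 * k.+2 + 2 * m' * k.+1 + 2 * k.+1)%N by lia.
  by move: (k.+1 * k.+2 + _)%N => e; rewrite exprD; ring.
rewrite E2 big_add1 /H1 -[in RHS](prednK L_gt0).
rewrite big_nat_recr //= mulrDr mulrA -exprD.
rewrite [X in _ + X * _]expr_nilp ?mul0r ?addr0; last by nia.
rewrite big_distrr /=; apply: eq_bigr => k _.
by rewrite mulrA -exprD; congr (_ ^+ _ * _); lia.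
Qed.

End Truncated.

(** * The generating function modulo 2 *)

Section CharacteristicTwo.

Local Open Scope ring_scope.

Variable R : comNzRingType.
Hypothesis char2 : 1 + 1 = 0 :> R.

Lemma addrr_char2 (x : R) : x + x = 0.
Proof. by rewrite -[x]mul1r -mulrDl char2 mul0r. Qed.

(** The terms at (i, j) and (j, i) cancel unless i = j. *)
Lemma symmetric_sum_char2 (F : nat -> nat -> R) n :
    (forall i j, F i j = F j i) ->
  \sum_(0 <= i < n) \sum_(0 <= j < n) F i j = \sum_(0 <= i < n) F i i.
Proof.
move=> symF; elim: n => [|n IH]; first by rewrite !big_geq.
rewrite !big_nat_recr //= -IH.
under eq_bigr => i _ do rewrite big_nat_recr //=.
rewrite big_split /= -!addrA; congr (_ + _).
under eq_bigr => i _ do rewrite symF.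
by rewrite addrA addrr_char2 add0r.
Qed.

Lemma sqr_sum_char2 (a : nat -> R) n :
  (\sum_(0 <= i < n) a i) ^+ 2 = \sum_(0 <= i < n) a i ^+ 2.
Proof.
rewrite expr2 big_distrl /=; under eq_bigr => i _ do rewrite big_distrr /=.
by rewrite symmetric_sum_char2 // => i j; rewrite mulrC.
Qed.

Lemma opp_char2 (x : R) : - x = x.
Proof. by apply/eqP; rewrite eq_sym -subr_eq0 opprK addrr_char2. Qed.

Variables (q : R) (L : nat).
Hypothesis qL0 : q ^+ L = 0.

(** The left-hand side is the generating function of EObar (2 * N). Expanding
    the odd factors makes it a symmetric double sum. *)
Lemma EO_series_char2 :
  \sum_(0 <= m < L)
     q ^+ m * (geomprod q L m * \prod_(m <= i < L) geom q L (2 * i + 1))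
  = \prod_(0 <= i < L) (1 - (q ^+ 4) ^+ i.+1).
Proof.
have -> : \prod_(0 <= i < L) (1 - (q ^+ 4) ^+ i.+1)
          = (\prod_(0 <= i < L) (1 + q ^+ (2 * i.+1))) ^+ 2.
  rewrite -prodrXl; apply: eq_bigr => i _.
  rewrite opp_char2 sqrrD expr1n mul1r -exprM -exprM.
  rewrite mulr2n addrr_char2 addr0; congr (_ + q ^+ _); lia.
rewrite prod_distinct_even // sqr_sum_char2.
pose F m k := q ^+ (m + k + 2 * m * k) * (geomprod q L m * geomprod q L k).
transitivity (\sum_(0 <= m < L) \sum_(0 <= k < L) F m k).
  rewrite !big_mkord; apply: eq_bigr => m _.
  rewrite prod_geom_odd ?(ltnW (ltn_ord m)) // mulrA big_distrr /=.
  apply: eq_bigr => k _; rewrite /F.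
  have -> : (m + k + 2 * m * k = m + (2 * m + 1) * k)%N by lia.
  by rewrite exprD; ring.
rewrite symmetric_sum_char2 => [|i j]; last first.
  by rewrite /F [geomprod q L i * _]mulrC; congr (q ^+ _ * _); lia.
apply: eq_bigr => m _; rewrite /F exprMn -exprM muln0 addn0 -expr2.
by congr (q ^+ _ * _); lia.
Qed.

End CharacteristicTwo.

(** * The pentagonal number theorem *)

Section Shanks.

Local Open Scope ring_scope.

Variables (R : comNzRingType) (x : R).

Definition shanks_term (n s : nat) : R :=
  (-1) ^+ s * (\prod_(s <= i < n) (1 - x ^+ i.+1)) * x ^+ (s * n + 'C(s.+1, 2)).

(** Here s * s + 'C(s, 2) and s * s + 'C(s.+1, 2) are the generalized pentagonal
    numbers s (3 s - 1) / 2 and s (3 s + 1) / 2. Passing from n to n.+1 changes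
    the term of index s <= n by D s.-1 - D s, where D s is the product of
    [shanks_term n s] and x ^+ (n.+1 + s). These changes telescope to - D n,
    which together with the new term of index n.+1 gives the two new pentagonal
    powers. *)
Lemma shanks n :
  \sum_(0 <= s < n.+1) shanks_term n s
  = 1 + \sum_(1 <= s < n.+1)
          (-1) ^+ s * (x ^+ (s * s + 'C(s, 2)) + x ^+ (s * s + 'C(s.+1, 2))).
Proof.
elim: n => [|n IH].
  by rewrite big_nat1 big_geq // /shanks_term big_geq // !mulr1 addr0.
rewrite big_nat_recr //= [in RHS]big_nat_recr //= addrA -IH.
set D : nat -> R := fun s =>
  (-1) ^+ s * \prod_(s <= i < n) (1 - x ^+ i.+1)
  * x ^+ (n.+1 + s + (s * n + 'C(s.+1, 2))).
have step s : (s < n.+1)%N ->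
   shanks_term n.+1 s
   = shanks_term n s - (D s - (if s is s'.+1 then D s' else 0)).
  rewrite ltnS => le_sn; rewrite /shanks_term /D big_nat_recr //=.
  case: s le_sn => [|s] lt_sn.
    by rewrite !mul0n !add0n !addn0 !expr0 subr0 !mul1r mulr1; ring.
  rewrite [\prod_(s <= i < n) _]big_ltn //; move: (\prod_(_ <= i < n) _) => P.
  rewrite [in 'C(s.+2, 2)]binS bin1; move: 'C(s.+1, 2) => c.
  rewrite [in LHS](_ : (s.+1 * n.+1 + _ = s * n + c + n + s.+1 + s.+1)%N);
    last by lia.
  rewrite [in X in _ = X - _](_ : (s.+1 * n + _ = s * n + c + n + s.+1)%N); last by lia.
  rewrite [in X in _ = _ - (X - _)]
    (_ : (n.+1 + s.+1 + _ = s * n + c + n + s.+1 + s.+1 + n.+1)%N); last by lia.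
  rewrite [in X in _ = _ - (_ - X)](_ : (n.+1 + s + _ = s * n + c + n + s.+1)%N);
    last by lia.
  by rewrite !exprD !exprS; ring.
rewrite (eq_big_nat _ _ (F2 := fun s => shanks_term n s
   - (D s - (if s is s'.+1 then D s' else 0)))); last by move=> s /step.
rewrite sumrB -addrA; congr (_ + _).
have -> : \sum_(0 <= s < n.+1) (D s - (if s is s'.+1 then D s' else 0)) = D n.
  by rewrite (telescope_sumr_eq (fun k => if k is s.+1 then D s else 0)) //= subr0.
rewrite /shanks_term /D !big_geq // [in LHS]binS bin1 ['C(n.+2,2)]binS bin1.
move: (binS n 1); rewrite bin1 => ->.
move: 'C(n, 2) => c.
rewrite exprS.
rewrite (_ : (n.+1 + n + _ = n.+1 * n.+1 + (c + n))%N); last by lia.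
ring.
Qed.

(** When x ^+ n = 0, only the term s = 0 survives on the left of [shanks]. *)
Lemma euler_pentagonal_truncated n : x ^+ n = 0 ->
  \prod_(0 <= i < n) (1 - x ^+ i.+1)
  = 1 + \sum_(1 <= s < n.+1)
          (-1) ^+ s * (x ^+ (s * s + 'C(s, 2)) + x ^+ (s * s + 'C(s.+1, 2))).
Proof.
move=> xn0; rewrite -shanks [RHS]big_nat_recl // [X in _ + X]big1 ?addr0 => [|s _].
  by rewrite /shanks_term mul0n add0n bin_small // !expr0 mul1r mulr1.
by rewrite /shanks_term mulSn !exprD xn0 !mul0r mulr0.
Qed.

End Shanks.

(** * Partitions counted by EObar as multiplicity functions *)

Definition is_EO (n : nat) (p : seq nat) : bool :=
  [&& is_partn n p, evens_below_odds p & only_largest_even_odd_times p].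

(** The i-th smallest part (i starting from 0) allowed beside a largest even
    part 2 m: the even numbers up to 2 m and the odd numbers above it, exactly
    one from each pair {2 i + 1, 2 i + 2}. *)
Definition allowed (m i : nat) : nat := 2 * i + 1 + (i < m).

(** The extra copy makes 2 m the only part of odd multiplicity; it is absent when
    m = 0, for then there is no even part. *)
Definition EOparts (L m : nat) (f : nat -> nat) : seq nat :=
  nseq (0 < m) (2 * m) ++ flatten [seq nseq (2 * f i) (allowed m i) | i <- iota 0 L].

Lemma allowed_gt0 m i : 0 < allowed m i.
Proof. by rewrite /allowed addn1. Qed.

Lemma allowed_inj m : injective (allowed m).
Proof. by rewrite /allowed => i j; case: ltnP; case: ltnP => /=; lia. Qed.

Lemma sumn_EOparts L m f :
  sumn (EOparts L m f) = 2 * (m + \sum_(0 <= i < L) f i * allowed m i).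
Proof.
rewrite sumn_cat sumn_nseq sumn_flatten -map_comp sumnE big_map mulnDr big_distrr /=.
congr (_ + _); first by case: m => [|m]; rewrite ?muln0 ?muln1.
rewrite /index_iota subn0; apply: eq_bigr => i _; rewrite /= sumn_nseq; lia.
Qed.

Lemma count_EOparts L m f a :
  count_mem a (EOparts L m f)
  = (0 < m) * (2 * m == a) + \sum_(0 <= i < L) (allowed m i == a) * (2 * f i).
Proof.
rewrite count_cat count_nseq count_flatten -map_comp sumnE big_map /=.
congr (_ + _); first by rewrite mulnC.
by rewrite /index_iota subn0; apply: eq_bigr => i _; rewrite /= count_nseq.
Qed.

Lemma count_allowed_EOparts L m f i : i < L ->
  count_mem (allowed m i) (EOparts L m f) = (i.+1 == m) + 2 * f i.
Proof.
move=> lt_iL; rewrite count_EOparts (bigD1_seq i) ?mem_index_iota ?iota_uniq //=.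
rewrite eqxx mul1n big1 ?addn0 => [|j /negPf ne_ji]; last first.
  by rewrite (inj_eq (@allowed_inj m)) ne_ji.
congr (_ + _); rewrite /allowed.
case: ltnP => /= lt_im; case: m lt_im => [|m] //= lt_im; rewrite ?mul1n; lia.
Qed.

Lemma mem_EOparts L m f a : a \in EOparts L m f ->
  (0 < m /\ a = 2 * m) \/ (exists2 i, i < L & a = allowed m i).
Proof.
rewrite mem_cat => /orP[|/flattenP[s /mapP[i]]].
  by rewrite mem_nseq lt0b => /andP[? /eqP ->]; left.
rewrite mem_iota /= add0n => lt_iL ->; rewrite mem_nseq => /andP[_ /eqP ->].
by right; exists i.
Qed.

Lemma even_EOparts L m f a : a \in EOparts L m f -> ~~ odd a -> a <= 2 * m.
Proof.
move=> /mem_EOparts[[_ ->] //|[i _ ->]]; rewrite /allowed; case: ltnP => /= lt_im; lia.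
Qed.

Lemma odd_EOparts L m f a : a \in EOparts L m f -> odd a -> 2 * m < a.
Proof.
move=> /mem_EOparts[[_ ->]|[i _ ->]]; first by rewrite mul2n odd_double.
by rewrite /allowed; case: ltnP => /= lt_im; lia.
Qed.

Lemma even_largest_even p : ~~ odd (largest_even p).
Proof.
rewrite /largest_even; elim/big_rec: _ => // a b even_a even_b.
by rewrite /maxn; case: ifP.
Qed.

Lemma mem_largest_even p : 0 < largest_even p -> largest_even p \in p.
Proof.
rewrite /largest_even; elim: p => [|a p IH]; first by rewrite big_nil.
rewrite big_cons inE; case: ifP => _; last by move=> /IH ->; rewrite orbT.
by rewrite /maxn; case: ifP => _; [move=> /IH -> | ]; rewrite ?orbT ?eqxx.
Qed.

Lemma leq_largest_even p a : a \in p -> ~~ odd a -> a <= largest_even p.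
Proof. by move=> pa ea; exact: (leq_bigmax_seq (F := fun a : nat => a)). Qed.

Lemma leq_sumn_mem p a : a \in p -> a <= sumn p.
Proof.
elim: p => //= b p IH; rewrite inE => /orP[/eqP ->|/IH le_a]; first exact: leq_addr.
exact: leq_trans le_a (leq_addl _ _).
Qed.

Lemma EOparts_EO N m (f : nat -> nat) :
    m + \sum_(0 <= i < N.+1) f i * allowed m i = N ->
  let p := sort geq (EOparts N.+1 m f) in
  [/\ is_EO (2 * N) p, largest_even p = 2 * m
    & forall i, i < N.+1 -> (count_mem (allowed m i) p)./2 = f i].
Proof.
move=> sumN p.
have pE : perm_eq p (EOparts N.+1 m f) by rewrite perm_sort.
have mem_pE := perm_mem pE.
have leE : largest_even p = 2 * m.
  apply/eqP; rewrite eqn_leq; apply/andP; split.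
    apply/bigmax_leqP_seq => a; rewrite mem_pE => pa ea.
    exact: even_EOparts pa ea.
  case: (posnP m) => [->//|m_gt0]; apply: leq_largest_even.
    by rewrite mem_pE mem_cat m_gt0 mem_nseq eqxx.
  by rewrite mul2n odd_double.
split=> // [|i lt_iN]; last first.
  rewrite (permP pE) count_allowed_EOparts // mul2n; exact: half_bit_double.
apply/and3P; split.
- apply/and3P; split.
  + by apply: sort_sorted => a b; exact: leq_total.
  + apply/allP => a; rewrite mem_pE => /mem_EOparts[[m_gt0 ->]|[i _ ->]].
      by rewrite /= muln_gt0.
    exact: allowed_gt0.
  + by rewrite (perm_sumn pE) sumn_EOparts sumN.
- apply/allrelP => a b; rewrite !mem_filter !mem_pE => /andP[ea pa] /andP[ob pb].
  exact: leq_ltn_trans (even_EOparts pa ea) (odd_EOparts pb ob).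
- apply/allP => a; rewrite mem_pE leE => pa; rewrite (permP pE) count_EOparts.
  rewrite oddD (big_morph odd oddD (erefl _)) big1 ?addbF => [|i _]; last first.
    by rewrite mulnCA mul2n odd_double.
  case: (posnP m) => [m0|m_gt0]; last by rewrite /= mul1n oddb (eq_sym a).
  move: pa => /mem_EOparts; rewrite m0 => -[[//]|[i _ ->]].
  by rewrite eq_sym (gtn_eqF (allowed_gt0 _ _)).
Qed.

(** Every part of an EO partition is allowed for its own largest even part, and
    its multiplicity is odd only for that part, so halving the multiplicities
    loses no information. *)
Lemma EO_perm_EOparts N p : is_EO (2 * N) p ->
  perm_eq p (EOparts N.+1 (largest_even p)./2
               (fun i => (count_mem (allowed (largest_even p)./2 i) p)./2)).
Proof.
case/and3P=> /and3P[_ /allP p_gt0 /eqP sum_p] /allrelP ebo /allP onlyp.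
set m := (largest_even p)./2.
have leE : largest_even p = 2 * m.
  by rewrite mul2n -[LHS]odd_double_half (negPf (even_largest_even p)).
have le_mN : m <= N.
  case: (posnP m) => [->//|m_gt0].
  have /leq_sumn_mem : largest_even p \in p by apply: mem_largest_even; lia.
  rewrite sum_p; lia.
apply/allP => a _; apply/eqP; rewrite [RHS]count_EOparts.
have [pa|npa] := boolP (a \in p); last first.
  rewrite (count_memPn npa) big1 => [|i _].
    rewrite addn0; case: (posnP m) => [//|m_gt0].
    case: eqP => // Ea; case/negP: npa; rewrite -Ea -leE; apply: mem_largest_even.
    by rewrite leE muln_gt0.
  by case: eqP => // ->; rewrite (count_memPn npa) muln0.
have a_gt0 : 0 < a := p_gt0 a pa.
have le_aN : a <= 2 * N by rewrite -sum_p leq_sumn_mem.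
have [i lt_iN Ei] : exists2 i, i < N.+1 & allowed m i = a.
  have [oa|ea] := boolP (odd a).
    have le_ma : 2 * m < a.
      case: (posnP m) => [->//|m_gt0]; rewrite -leE; apply: ebo;
        rewrite mem_filter ?oa //.
      by rewrite even_largest_even mem_largest_even // leE muln_gt0.
    by exists a./2; rewrite /allowed; [lia | case: ltnP => /=; lia].
  have le_am : a <= 2 * m by rewrite -leE leq_largest_even.
  by exists (a./2).-1; rewrite /allowed; [lia | case: ltnP => /=; lia].
rewrite (bigD1_seq i) ?mem_index_iota ?iota_uniq //=.
rewrite -Ei eqxx mul1n big1 ?addn0 => [|j /negPf ne_ji]; last first.
  by rewrite (inj_eq (@allowed_inj m)) ne_ji.
rewrite Ei -[LHS]odd_double_half; congr (_ + _); last by rewrite mul2n.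
rewrite (eqP (onlyp a pa)) leE.
case: (posnP m) => [m0|_]; last first.
  by rewrite /= mul1n eq_sym.
by rewrite mul0n m0 gtn_eqF.
Qed.

(** All of m, the indices and the multiplicities are at most N, which makes the
    set of codes finite. *)
Definition EOcodes (N : nat) :=
  [pred c : 'I_N.+1 * {ffun 'I_N.+1 -> 'I_N.+1} |
     c.1 + \sum_(i < N.+1) c.2 i * allowed c.1 i == N].

Lemma card_EOcodes N : EObar (2 * N) = #|EOcodes N|.
Proof.
pose parts (s : (2 * N).-bseq 'I_(2 * N).+1) := [seq val i | i <- s].
pose m p := (largest_even p)./2.
pose f p i := (count_mem (allowed (m p) i) p)./2.
pose code s : 'I_N.+1 * {ffun 'I_N.+1 -> 'I_N.+1} :=
  (inord (m (parts s)), [ffun i : 'I__ => inord (f (parts s) i)]).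
pose X := [pred s | is_EO (2 * N) (parts s)].
have sumE s : s \in X ->
    m (parts s) + \sum_(0 <= i < N.+1) f (parts s) i * allowed (m (parts s)) i = N.
  move=> Xs; have /and3P[/and3P[_ _ /eqP]] := Xs.
  rewrite (perm_sumn (EO_perm_EOparts Xs)) sumn_EOparts => /eqP.
  by rewrite eqn_pmul2l // => /eqP.
have codem s : s \in X -> (code s).1 = m (parts s) :> nat.
  by move=> /sumE sE; rewrite inordK // ltnS -[X in _ <= X]sE leq_addr.
have codef s (i : 'I_N.+1) : s \in X -> (code s).2 i = f (parts s) i :> nat.
  move=> /sumE sE; rewrite ffunE inordK // ltnS -[X in _ <= X]sE big_mkord (bigD1 i) //=.
  have := allowed_gt0 (m (parts s)) i; nia.
have -> : EObar (2 * N) = #|X| by [].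
rewrite -(card_in_imset (f := code) (D := X)) => [|s s' Xs Xs' eq_c]; last first.
  have eq_m : m (parts s) = m (parts s') by rewrite -codem // eq_c codem.
  have eq_f i : i < N.+1 -> f (parts s) i = f (parts s') i.
    move=> lt_iN; rewrite -[i]/(nat_of_ord (Ordinal lt_iN)).
    by rewrite -codef // eq_c codef.
  apply/val_inj/(inj_map val_inj); rewrite -/(parts s) -/(parts s').
  have sorted_s t : t \in X -> sorted geq (parts t) by case/and3P=> /and3P[].
  apply: (sorted_eq (leT := geq)) (sorted_s s Xs) (sorted_s s' Xs') _.
  - by move=> a b c /= le_ab le_bc; exact: leq_trans le_bc le_ab.
  - by move=> a b; rewrite /= andbC => /anti_leq.
  apply: (perm_trans (EO_perm_EOparts Xs)).
  rewrite perm_sym; apply: (perm_trans (EO_perm_EOparts Xs')).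
  rewrite -/(m _) -/(m _) /EOparts eq_m.
  set l1 := flatten _; set l2 := flatten _; suff -> : l1 = l2 by [].
  congr flatten; apply/eq_in_map => i; rewrite mem_iota => /andP[_ lt_iN]; congr nseq.
  by rewrite -[(count_mem _ (parts s'))./2]/(f (parts s') i) -eq_f // /f eq_m.
apply: eq_card => -[m0 f0]; apply/imsetP/idP => [[s Xs ->]|]; rewrite inE /=.
  rewrite codem //; apply/eqP; rewrite -[RHS](sumE s Xs) big_mkord; congr (_ + _).
  by apply: eq_bigr => i _; rewrite codef.
(* Conversely, the sorted list of parts described by a code is an EO partition. *)
set g := fun i => f0 (inord i) : nat => /eqP sum0.
have [] := @EOparts_EO N m0 g.
  rewrite big_mkord -[RHS]sum0; congr (_ + _).
  by apply: eq_bigr => i _; rewrite /g inord_val.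
set p := sort _ _ => EOp le_p cnt_p.
have sum_p : sumn p = 2 * N by case/and3P: EOp => /and3P[_ _ /eqP].
have p_gt0 : all (ltn 0) p by case/and3P: EOp => /and3P[].
have size_p : size p <= 2 * N.
  rewrite -sum_p; elim: (p) p_gt0 => //= a p' IH /andP[a_gt0 /IH]; lia.
have size_s : size [seq inord a : 'I_(2 * N).+1 | a <- p] <= 2 * N by rewrite size_map.
have partsE : parts (Bseq size_s) = p.
  rewrite /parts /= -map_comp -[RHS]map_id; apply/eq_in_map => a pa /=.
  by rewrite inordK // ltnS -sum_p leq_sumn_mem.
have mE : m p = m0 by rewrite /m le_p mul2n doubleK.
exists (Bseq size_s); first by rewrite inE partsE.
rewrite /code partsE mE inord_val; congr pair; apply/ffunP => i; rewrite ffunE.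
by rewrite /f mE cnt_p // /g !inord_val.
Qed.

(** * The parity of EObar (2 * N) *)

Section Parity.

Local Open Scope ring_scope.

Lemma coef_eq_in_qpolyXn (R : comNzRingType) (p p' : {poly R}) n i :
  (i < n)%N -> in_qpoly 'X^n p = in_qpoly 'X^n p' -> p`_i = p'`_i.
Proof.
move=> lt_in /(congr1 val) /=.
rewrite mk_monic_Xn (ltn_predK lt_in) => eq_mod.
have coef_mod (r : {poly R}) : r`_i = (Pdiv.CommonRing.rmodp r 'X^n)`_i.
  rewrite [in LHS](Pdiv.RingMonic.rdivp_eq (monicXn R n) r).
  by rewrite coefD coefMXn lt_in add0r.
by rewrite coef_mod eq_mod -coef_mod.
Qed.

Lemma natr_bool n : n%:R = odd n :> bool.
Proof. by elim: n => // n IH; rewrite mulrS IH. Qed.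

(** Coefficients are taken in the two-element field, realized as bool with exclusive
    or as addition. *)
Definition EOpoly (N : nat) : {poly bool} :=
  \sum_(m < N.+1) 'X^m * \prod_(i < N.+1) \sum_(k < N.+1) 'X^(allowed m i * k).

(** Distributing the product over the sums turns the coefficient into the number
    of codes. *)
Lemma coef_EOpoly N : (EOpoly N)`_N = odd (EObar (2 * N)).
Proof.
rewrite card_EOcodes -natr_bool -sum1_card natr_sum.
rewrite [RHS]big_mkcond /= coef_sum.
rewrite -(pair_bigA _ (fun (m : 'I_N.+1) (f : {ffun 'I_N.+1 -> 'I_N.+1}) =>
   if (m + \sum_(i < N.+1) f i * allowed m i == N)%N then 1 else 0 : bool)) /=.
apply: eq_bigr => m _.
rewrite bigA_distr_bigA big_distrr coef_sum /=; apply: eq_bigr => f _.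
rewrite -expr_sum -exprD coefXn eq_sym.
under eq_bigr => i _ do rewrite mulnC.
by case: eqP.
Qed.

Definition pentagonal_poly (N : nat) : {poly bool} :=
  1 + \sum_(1 <= s < N.+2)
        ('X^(4 * (s * s + 'C(s, 2))) + 'X^(4 * (s * s + 'C(s.+1, 2)))).

(** In the image of phi the truncated factors of [EOpoly] become the series
    [geom], and the previous identities apply; signs disappear because
    the image has characteristic 2. *)
Lemma EOpoly_rmorph (R : comNzRingType) (phi : {rmorphism {poly bool} -> R}) N :
  phi 'X ^+ N.+1 = 0 -> phi (EOpoly N) = phi (pentagonal_poly N).
Proof.
set q := phi 'X => qL0.
have qX k : phi 'X^k = q ^+ k by rewrite rmorphXn.
have char2 : 1 + 1 = 0 :> R.
  rewrite -(rmorph1 phi) -rmorphD /= (_ : 1 + 1 = 0) ?rmorph0 //.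
  by rewrite -polyCD.
transitivity (\sum_(0 <= m < N.+1) q ^+ m
   * (geomprod q N.+1 m * \prod_(m <= i < N.+1) geom q N.+1 (2 * i + 1))).
  rewrite /EOpoly rmorph_sum big_mkord; apply: eq_bigr => m _.
  rewrite rmorphM rmorph_prod /= qX; congr (_ * _).
  transitivity (\prod_(0 <= i < N.+1) geom q N.+1 (allowed m i)).
    rewrite big_mkord; apply: eq_bigr => j _; rewrite rmorph_sum.
    by apply: eq_bigr => k _; rewrite /= qX.
  rewrite (big_cat_nat (n := m)) ?(ltnW (ltn_ord m)) //=; congr (_ * _).
    apply: eq_big_nat => j /andP[_ lt_jm]; rewrite /allowed lt_jm; congr geom; lia.
  by apply: eq_big_nat => j /andP[le_mj _]; rewrite /allowed ltnNge le_mj addn0.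
rewrite (EO_series_char2 char2 qL0) euler_pentagonal_truncated; last first.
  by rewrite -exprM mulnC exprM qL0 expr0n.
rewrite /pentagonal_poly rmorphD rmorph1 rmorph_sum; congr (_ + _).
apply: eq_bigr => s _; rewrite rmorphD /= !qX -!exprM -signr_odd.
by case: odd; rewrite ?expr0 ?expr1 ?mul1r // mulN1r (opp_char2 char2).
Qed.

Lemma EOpoly_pentagonal N i : (i <= N)%N -> (EOpoly N)`_i = (pentagonal_poly N)`_i.
Proof.
move=> le_iN; apply: (@coef_eq_in_qpolyXn _ _ _ N.+1) => //.
apply: (EOpoly_rmorph (phi := in_qpoly 'X^(N.+1))).
rewrite -rmorphXn; apply/val_inj.
by rewrite /= mk_monic_Xn /= Pdiv.RingMonic.rmodpp ?monicXn.
Qed.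

Lemma double_bin2 s : ('C(s, 2) + 'C(s, 2) + s = s * s)%N.
Proof.
elim: s => // s IH; rewrite binS bin1; lia.
Qed.

(** In [pentagonal_poly], index s accounts for k = s and k = - s. Since
    6 N + 1 determines |6 k - 1| and hence k, at most one index contributes to
    the coefficient of degree N, so no cancellation modulo 2 takes place. *)
Lemma odd_EObarP N :
  odd (EObar (2 * N)) <-> exists k : int, N%:Z = 2 * k * (3 * k - 1).
Proof.
rewrite -coef_EOpoly EOpoly_pentagonal // coefD coef1 coef_sum.
pose hit s := (N == 4 * (s * s + 'C(s, 2)))%N || (N == 4 * (s * s + 'C(s.+1, 2)))%N.
have -> : \sum_(1 <= s < N.+2) ('X^(4 * (s * s + 'C(s, 2)))
      + 'X^(4 * (s * s + 'C(s.+1, 2))) : {poly bool})`_N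
    = \sum_(1 <= s < N.+2) hit s :> bool.
  apply: eq_big_nat => s /andP[s_gt0 _]; rewrite coefD !coefXn /hit.
  have := double_bin2 s; have := double_bin2 s.+1.
  by case: eqP => E1; case: eqP => E2 //; lia.
have hit_inj s t : hit s -> hit t -> s = t.
  have := double_bin2 s; have := double_bin2 s.+1.
  have := double_bin2 t; have := double_bin2 t.+1.
  move=> E1 E2 E3 E4; rewrite /hit; case: (ltngtP s t) => // lt_st H1 H2; exfalso; nia.
have hitE s : hit s <-> N%:Z = 2 * s%:Z * (3 * s%:Z - 1)
                        \/ N%:Z = 2 * - s%:Z * (3 * - s%:Z - 1).
  have := double_bin2 s; have := double_bin2 s.+1 => *; rewrite /hit.
  by split; [case/orP=> /eqP ->; [left | right] | case=> ?; apply/orP; [left|right]]; nia.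
have -> : (exists k : int, N%:Z = 2 * k * (3 * k - 1)) <-> exists s : nat, hit s.
  split=> [[[s|s] Ek]|[s /hitE[] E]].
  - by exists s; apply/hitE; left.
  - by exists s.+1; apply/hitE; right.
  - by exists s%:Z.
  - by exists (- s%:Z).
case: (posnP N) => [N0|N_gt0].
  rewrite big1_seq => [|s]; last first.
    rewrite mem_index_iota => /andP[_ /andP[s_gt0 _]]; apply: negbTE.
    rewrite /hit N0 negb_or !(eq_sym 0%N) -!lt0n.
    by rewrite !muln_gt0 !addn_gt0 !muln_gt0 s_gt0.
  by split=> // _; exists 0%N; rewrite /hit N0.
rewrite /= mulr0n add0r; split=> [|[s hit_s]].
  case: (boolP (has hit (index_iota 1 N.+2))) => [/hasP[s _ ?]|/hasPn nhit].
    by exists s.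
  by rewrite big1_seq // => s /andP[_ /nhit /negPf].
have s_in : s \in index_iota 1 N.+2.
  rewrite mem_index_iota; move: hit_s; rewrite /hit.
  have := double_bin2 s; have := double_bin2 s.+1; nia.
rewrite (bigD1_seq s) ?iota_uniq //= hit_s big1 // => t ne_ts.
by apply: (contraNF _ ne_ts) => hit_t; apply/eqP/hit_inj.
Qed.

End Parity.

Local Open Scope classical_set_scope.
Local Open Scope ring_scope.

(** * Arithmetic progressions *)

Lemma infinite_set_unbounded (A : set nat) :
  (forall B : nat, exists2 N : nat, (B < N)%N & A N) -> infinite_set A.
Proof.
move=> unbA /finite_seqP[s As].
have [N ltN] := unbA (\max_(x <- s) x)%N.
rewrite As /= => /(leq_bigmax_seq (F := fun a : nat => a) N)/(_ isT).
by rewrite leqNgt ltN.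
Qed.

Lemma eqz_mod_exists (m n d : int) :
  (m = n %[mod d])%Z <-> exists z : int, m = n + z * d.
Proof.
split=> [/eqP|[z ->]]; last by rewrite addrC modzMDl.
by rewrite eqz_mod_dvd => /dvdzP[z Ez]; exists z; rewrite -Ez addrC subrK.
Qed.

(** As y >= 3 t, the gap x^2 - y^2 >= 2 y + 1 is larger than 6 t. *)
Lemma squares_6_mul_apart (N t x y : nat) : (0 < t)%N -> (6 * t * t <= N)%N ->
  (6 * (N + t) + 1 = x * x)%N -> (6 * N + 1 = y * y)%N -> False.
Proof.
move=> t_gt0 leN Ex Ey.
have lt_yx : (y < x)%N.
  rewrite ltnNge; apply/negP => le_xy; have := leq_mul le_xy le_xy; lia.
have le_ty : (3 * t <= y)%N.
  rewrite leqNgt; apply/negP => /ltnW lt_yt; have := leq_mul lt_yt lt_yt; lia.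
have := leq_mul lt_yx lt_yx; lia.
Qed.

(** If N is large and EObar (2 * N) is odd, then EObar (2 * (N + t)) is even,
    since 6 N + 1 and 6 (N + t) + 1 are not both squares. *)
Lemma even_EObar_unbounded (t : nat) (r : int) (B : nat) : (0 < t)%N ->
  exists2 N : nat, (B < N)%N & (N%:Z = r %[mod t%:Z])%Z /\ ~~ odd (EObar (2 * N)).
Proof.
move=> t_gt0.
have t_neq0 : t%:Z != 0 by lia.
pose r0 := `|(r %% t%:Z)%Z|%N.
have r0E : r0%:Z = (r %% t%:Z)%Z by rewrite gez0_abs // modz_ge0.
pose N := (r0 + t * (B + 6 * t).+1)%N.
have ltBN : (B < N)%N by rewrite /N; nia.
have leN : (6 * t * t <= N)%N by rewrite /N; nia.
have modN c : ((N + t * c)%:Z = r %[mod t%:Z])%Z.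
  apply/eqz_mod_exists; exists ((B + 6 * t).+1%:Z + c%:Z - (r %/ t%:Z)%Z).
  have := divz_eq r t%:Z; rewrite -r0E /N; lia.
have [odd0|even0] := boolP (odd (EObar (2 * N))); last first.
  by exists N => //; split=> //; have := modN 0%N; rewrite muln0 addn0.
exists (N + t)%N; first by apply: ltn_addr.
split; first by have := modN 1%N; rewrite muln1.
apply/negP => /odd_EObarP[k Ek]; move/odd_EObarP: odd0 => [l El].
have sqr (k' : int) (M : nat) : Posz M = 2 * k' * (3 * k' - 1) ->
    (6 * M + 1 = absz (6 * k' - 1)%R * absz (6 * k' - 1)%R)%N.
  by move=> EM; rewrite -abszM; nia.
move: (sqr _ _ Ek) (sqr _ _ El); move: `|_|%N `|_|%N => x y Ex Ey.
exact: squares_6_mul_apart t_gt0 leN Ex Ey.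
Qed.

(** Replace k by k + t c with c large. *)
Lemma odd_EObar_unbounded (t : nat) (r : int) (B M : nat) : (0 < t)%N ->
    (M%:Z = r %[mod t%:Z])%Z -> odd (EObar (2 * M)) ->
  exists2 M' : nat, (B < M')%N & (M'%:Z = r %[mod t%:Z])%Z /\ odd (EObar (2 * M')).
Proof.
move=> t_gt0 modM /odd_EObarP[k Ek].
pose c : nat := (`|k| + B).+1.
pose k' := k + t%:Z * c%:Z.
have lt_Bk' : B%:Z < k' by rewrite /k' /c; nia.
have E' : (absz (2 * k' * (3 * k' - 1)))%:Z = 2 * k' * (3 * k' - 1).
  by rewrite gez0_abs //; nia.
exists (absz (2 * k' * (3 * k' - 1))); first by nia.
split; last by apply/odd_EObarP; exists k'.
rewrite -modM E' Ek; apply/eqz_mod_exists.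
exists (2 * c%:Z * (6 * k + 3 * t%:Z * c%:Z - 1)); rewrite /k'; ring.
Qed.

(** Replace k by the residue l modulo t of least absolute value: as 2 |l| <= t,
    2 l (3 l - 1) <= 3 t^2 / 2 + t < 3 t^2. *)
Lemma odd_EObar_small (t : nat) (r : int) (M : nat) : (0 < t)%N ->
    (M%:Z = r %[mod t%:Z])%Z -> odd (EObar (2 * M)) ->
  exists2 M' : nat, (M' < 3 * t * t)%N
    & (M'%:Z = r %[mod t%:Z])%Z /\ odd (EObar (2 * M')).
Proof.
move=> t_gt0 modM /odd_EObarP[k Ek].
have [l [z Ez] ltl] : exists2 l, exists z, l = k + t%:Z * z & (- t%:Z <= 2 * l <= t%:Z).
  have t_neq0 : t%:Z != 0 by lia.
  have := divz_eq k t; have := modz_ge0 k t_neq0.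
  have := @ltz_pmod k t ltac:(lia).
  move: (k %% t)%Z (k %/ t)%Z => a b lt_at a_ge0 kE.
  case: (lerP (2 * a) t%:Z) => ?.
    by exists a; [exists (- b) |]; lia.
  by exists (a - t%:Z); [exists (- b - 1) |]; lia.
have E' : (absz (2 * l * (3 * l - 1)))%:Z = 2 * l * (3 * l - 1).
  by rewrite gez0_abs //; nia.
exists (absz (2 * l * (3 * l - 1))); first by move/andP: ltl => [? ?]; clear Ek Ez; nia.
split; last by apply/odd_EObarP; exists l.
rewrite -modM E' Ek; apply/eqz_mod_exists.
exists (2 * z * (6 * k + 3 * t%:Z * z - 1)); rewrite Ez; ring.
Qed.

(** The left-hand side is the telescoping product of 1 - 1 / p^2 over all
    integers p > a. *)
Lemma prod_1subVsqr_ge (a : nat) (s : seq nat) : (0 < a)%N -> path ltn a s ->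
  a%:R / (a%:R + 1) <= \prod_(p <- s) (1 - 1 / p%:R ^+ 2) :> rat.
Proof.
elim: s a => [|b s IH] a a_gt0 /=.
  by move=> _; rewrite big_nil ler_pdivrMr ?mul1r ?ltr_wpDl ?lerDl.
move=> /andP[lt_ab pths]; rewrite big_cons.
have b_gt0 : (0 < b)%N by apply: leq_ltn_trans lt_ab.
have a0 : 0 < a%:R :> rat by rewrite ltr0n.
have b0 : 0 < b%:R :> rat by rewrite ltr0n.
have leab : a%:R + 1 <= b%:R :> rat by rewrite natr1 ler_nat.
have f_ge0 : 0 <= 1 - 1 / b%:R ^+ 2 :> rat.
  rewrite subr_ge0 ler_pdivrMr ?exprn_gt0 // mul1r -natrX ler1n expn_gt0 b_gt0 //.
apply: le_trans (ler_wpM2l f_ge0 (IH b b_gt0 pths)).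
have -> : (1 - 1 / b%:R ^+ 2) * (b%:R / (b%:R + 1)) = (b%:R - 1) / b%:R :> rat.
  by field; rewrite !gt_eqF // addr_gt0.
rewrite ler_pdivrMr ?ltr_wpDl // mulrAC ler_pdivlMr //; nra.
Qed.

Lemma prod_primes_ge_half n : 1 / 2 <= \prod_(p <- primes n) (1 - 1 / p%:R ^+ 2) :> rat.
Proof.
apply: (@prod_1subVsqr_ge 1) => //.
have := sorted_primes n; case E: (primes n) => [//|p s] /= ->; rewrite andbT.
by apply: prime_gt1; have := mem_head p s; rewrite -E mem_primes => /andP[].
Qed.

(** Since d <= t, the quotient t^6 / d^2 is at least t^4 >= t; the right-hand side
    is therefore at least 36 t 2^j, and 36 t (t / 12) = 3 t^2. *)
Lemma bound_ge_3sqr (t : nat) (d : int) (j : int) (P : rat) :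
    (0 < t)%N -> 0 < d <= t%:Z -> 1 / 2 <= P -> t%:R / 12 < 2 ^ j :> rat ->
  (3 * t * t)%:R
  <= 2 ^ (9 + j) * 3 ^+ 7 * t%:R ^+ 6 / d%:~R ^+ 2 * P - 2 ^ j :> rat.
Proof.
move=> t_gt0 /andP[d_gt0 le_dt] P_ge ltj.
have T1 : 1 <= t%:R :> rat by rewrite ler1n.
have D0 : 0 < d%:~R :> rat by rewrite ltr0z.
have DT : d%:~R <= t%:R :> rat by rewrite -[t%:R]/((t%:Z)%:~R) ler_int.
have -> : 2 ^ (9 + j) = 512 * 2 ^ j :> rat.
  rewrite expfzDr // -exprnP; congr (_ * _); ring.
rewrite !natrM; move: (2 ^ j) (t%:R : rat) (d%:~R : rat) ltj T1 D0 DT.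
move=> J T D ltj T1 D0 DT.
have TD : T ^+ 4 <= T ^+ 6 / D ^+ 2.
  rewrite ler_pdivlMr ?exprn_gt0 // (exprD T 4 2) ler_wpM2l ?exprn_ge0 //; first by lra.
  by rewrite ler_sqr ?nnegrE //; lra.
have T4 : T <= T ^+ 4 by rewrite -[leLHS]expr1 ler_weXn2l.
have J0 : 0 < J by lra.
pose Q := T ^+ 6 / D ^+ 2 * P.
have QP : T ^+ 4 / 2 <= Q.
  rewrite /Q.
  have : 0 <= T ^+ 4 by apply: exprn_ge0; lra.
  move: TD; move: (T ^+ 4) (T ^+ 6 / D ^+ 2) => u v le_uv u_ge0; nra.
have -> : 512 * J * 3 ^+ 7 * T ^+ 6 / D ^+ 2 * P = J * (512 * 3 ^+ 7 * Q).
  by rewrite /Q; ring.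
have QT : T / 2 <= Q by lra.
have step : 36 * T <= 512 * 3 ^+ 7 * Q - 1 by lra.
apply: (@le_trans _ _ (J * (36 * T))); last by rewrite -subr_ge0; nra.
nra.
Qed.

Theorem theorem1p4 (t : nat) (r : int) (ht : (0 < t)%N) :
  [/\ infinite_set
        [set N : nat | (N%:Z = r %[mod t%:Z])%Z /\ ~~ odd (EObar (2 * N))],
      (exists M : nat, (M%:Z = r %[mod t%:Z])%Z /\ odd (EObar (2 * M))) ->
      infinite_set
        [set M : nat | (M%:Z = r %[mod t%:Z])%Z /\ odd (EObar (2 * M))]
    & (exists M : nat, (M%:Z = r %[mod t%:Z])%Z /\ odd (EObar (2 * M))) ->
      exists M : nat,
        [/\ (M%:Z = r %[mod t%:Z])%Z /\ odd (EObar (2 * M)),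
            forall M' : nat,
              (M'%:Z = r %[mod t%:Z])%Z /\ odd (EObar (2 * M')) -> (M <= M')%N
          & forall j : int, (t%:R / 12 < 2 ^ j :> rat) ->
            (M%:R : rat) <
              2 ^ (9 + j) * 3 ^+ 7 * t%:R ^+ 6
                / (gcdz (12 * r - 1) t%:Z)%:~R ^+ 2
                * \prod_(p <- primes (6 * t)) (1 - 1 / p%:R ^+ 2)
              - 2 ^ j]].
Proof.
split.
- by apply: infinite_set_unbounded => B; apply: even_EObar_unbounded.
- case=> M [modM oddM]; apply: infinite_set_unbounded => B.
  exact: odd_EObar_unbounded modM oddM.
- case=> M0 [modM0 oddM0].
  pose hit M := (M%:Z == r %[mod t%:Z])%Z && odd (EObar (2 * M)).
  have hitP M : hit M <-> (M%:Z = r %[mod t%:Z])%Z /\ odd (EObar (2 * M)).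
    by split=> [/andP[/eqP ? ?]|[/eqP ? ?]]; last apply/andP.
  have ex_hit : exists M, hit M by exists M0; apply/hitP.
  case: (ex_minnP ex_hit) => M /hitP hitM minM; exists M; split=> //.
    by move=> M' /hitP; exact: minM.
  move=> j ltj.
  have [M' ltM' /hitP/minM leM] := odd_EObar_small ht modM0 oddM0.
  apply: lt_le_trans (bound_ge_3sqr ht _ (prod_primes_ge_half _) ltj).
    by rewrite ltr_nat (leq_ltn_trans leM).
  have d_dvd := dvdz_gcdr (12 * r - 1) t%:Z.
  have d_neq0 : gcdz (12 * r - 1) t%:Z != 0.
    by rewrite gcdz_eq0 negb_and orbC; apply/orP; left; lia.
  have d_ge0 : 0 <= gcdz (12 * r - 1) t%:Z by [].
  rewrite lt0r d_neq0 d_ge0 /=.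
  move: d_dvd; rewrite dvdzE => /(dvdn_leq ht); lia.
Qed.
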